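(* Let $X$ and $Y$ be metric spaces and let $f:X\to Y$ be a map. Then $f$ is not $F\cup LC_1$-measurable if and only if there exists a point $x\in X$ such that $f$ is not $F\cup LC_1$-measurable at $x$.
   Context: A subset of $X$ is an $LC_1$ set if it is the intersection of an open and a closed subset of $X$; it is an $F\cup LC_1$ set if it is the union of a closed set and an $LC_1$ set. The map $f$ (not assumed continuous) is not $F\cup LC_1$-measurable if there is an open set $U\subseteq Y$ such that $f^{-1}(U)$ is not an $F\cup LC_1$ set in $X$. Let $D_0=\{0\}\subset\mathbb{R}$ and, for $k\ge 1$, let $D_k=\{2^{-n_1}+\dots+2^{-n_k} : n_1<n_2<\dots<n_k,\ n_i\in\mathbb{N}^+\}$. Let $S_3=D_0\cup D_1\cup D_2\cup D_3$, a compact subspace of $\mathbb{R}$. For $x\in X$, a set $S_3(x)\subseteq X$ is the image of $S_3$ under some homeomorphism $h$ of $S_3$ onto a subspace of $X$ with $h(0)=x$; write $D_j(x)=h(D_j)$, so $S_3(x)=D_0(x)\cup D_1(x)\cup D_2(x)\cup D_3(x)$. The map $f$ is not $F\cup LC_1$-measurable at $x$ if there exist an open set $U\subseteq Y$ and such a set $S_3(x)$ with $f^{-1}(U)\cap S_3(x)=D_1(x)\cup D_3(x)$. *)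

(* Defs.v *)
From HB Require Import structures.
From mathcomp Require Import all_boot all_order all_algebra.
From mathcomp Require Import all_classical all_reals all_analysis.

Set Implicit Arguments.
Unset Strict Implicit.
Unset Printing Implicit Defensive.

Import Order.TTheory GRing.Theory Num.Theory.
Import numFieldNormedType.Exports.

Local Open Scope classical_set_scope.
Local Open Scope ring_scope.

Definition LC1 (T : topologicalType) (A : set T) : Prop :=
  exists O C : set T, [/\ open O, closed C & A = O `&` C].

Definition FLC1 (T : topologicalType) (A : set T) : Prop :=
  exists F B : set T, [/\ closed F, LC1 B & A = F `|` B].

Definition not_FLC1_measurable (X Y : topologicalType) (f : X -> Y) : Prop :=
  exists U : set Y, open U /\ ~ FLC1 (f @^-1` U).

(* For k = 0 the only sum is the empty one, see [dyadic0]. *)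
Definition dyadic (R : realType) (k : nat) : set R :=
  [set x | exists n : 'I_k -> nat,
    [/\ forall i, (0 < n i)%N,
        forall i j : 'I_k, (i < j)%N -> (n i < n j)%N
      & x = \sum_(i < k) 2 ^- (n i)]].
Arguments dyadic : clear implicits.

Lemma dyadic0 (R : realType) : dyadic R 0 = [set 0].
Proof.
apply/seteqP; split=> x /=; first by case=> n [_ _ ->]; rewrite big_ord0.
by move=> ->; exists (fun=> 1%N); split=> [[]|[]|] //; rewrite big_ord0.
Qed.

Definition S3 (R : realType) : set R :=
  dyadic R 0 `|` dyadic R 1 `|` dyadic R 2 `|` dyadic R 3.
Arguments S3 : clear implicits.

(* [h] restricts to a homeomorphism of the subspace [A] onto the subspace
   [h @` A]; the values of [h] outside [A] and of the inverse [g] outside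
   [h @` A] are irrelevant. *)
Definition homeo_onto_image (T U : topologicalType) (A : set T) (h : T -> U) :
    Prop :=
  exists g : U -> T,
    [/\ forall t, A t -> g (h t) = t,
        {within A, continuous h}
      & {within h @` A, continuous g}].

Definition not_FLC1_measurable_at (R : realType) (X Y : metricType R)
    (f : X -> Y) (x : X) : Prop :=
  exists (U : set Y) (h : R -> X),
    [/\ open U, homeo_onto_image (S3 R) h, h 0 = x
      & f @^-1` U `&` h @` S3 R = h @` dyadic R 1 `|` h @` dyadic R 3].

(* Main.v *)
Require Import Defs.
From mathcomp Require Import all_boot all_order all_algebra.
From mathcomp Require Import all_classical all_reals all_analysis.
From mathcomp Require Import lra.

Set Implicit Arguments.
Unset Strict Implicit.
Unset Printing Implicit Defensive.

Import Order.TTheory GRing.Theory Num.Theory.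
Import numFieldNormedType.Exports.
Import metricType_numDomainType.

Local Open Scope classical_set_scope.
Local Open Scope ring_scope.

(** Call [closure A `\` A] the residue of [A]. Each residue is disjoint from the
previous set and the double residue lies back inside, so that the iterated
residues [A = Q_0, Q_1, Q_2, Q_3] lie alternately inside and outside [A].
They measure how [A] fails to be a union of a closed set and an [LC1] set:
[A] always contains [Q_2] and [closure A `\` closure Q_1], and these two sets
cover it, so if [Q_3] is empty then [Q_2] is closed and [A] is such a union;
conversely any such decomposition forces [Q_3] to be empty ([FLC1_residueP]).

A point of [Q_3] is thus a limit of points of [Q_2], each of which is a limit of
points of [Q_1], each of which is a limit of points of [Q_0]: the shape of
[S3]. Points of this shape are indexed by sequences of natural numbers of length
at most 3; in [S3] the sequence [n1; ...; nk] names the sum of the [2 ^- m_i]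
with [m_0 = 0] and gaps [m_i - m_(i-1) = n_i + 1], which turns increasing exponents
into arbitrary indices ([dyadic_code], [dyadic_codeE]). Choosing the approximating points fast enough,
the subtree at the [n]-th child of each node sits in an annulus around that
node, the annuli of distinct children being disjoint and shrinking to the node
([branching], [iter_residue_branching]). The numbers in [S3] satisfy the same
condition ([dyadic_code_branching]). The annuli determine the topology of the
set of points, so any two such configurations are homeomorphic along their
indexing ([branching_homeo]). This yields the embedding of [S3] out of a point
of [Q_3]. Conversely, an embedding with the prescribed trace maps [D_3], [D_2],
[D_1], [D_0] into [Q_0], [Q_1], [Q_2], [Q_3] in turn, so [Q_3] is nonempty. *)

(** * Iterated residues and the class of unions of a closed and an LC1 set *)

Lemma closure_sub (T : topologicalType) (A B : set T) :
  closed B -> A `<=` B -> closure A `<=` B.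
Proof. by move=> /closure_id cB AB; rewrite cB; exact: closureS. Qed.

Definition residue (T : topologicalType) (A : set T) : set T :=
  closure A `\` A.

(** A point of the closure of [closure A `\` A] lies in [closure A]; if it is not
in [A], it is in the residue itself. *)
Lemma residue2_sub (T : topologicalType) (A : set T) :
  residue (residue A) `<=` A.
Proof.
move=> x [clx nx]; apply: contrapT => nAx; apply: nx; split=> //; move: x clx {nAx}.
by apply: closure_sub => [|y []//]; exact: closed_closure.
Qed.

Lemma iter_residue_parity (T : topologicalType) (A : set T) k x :
  iter k (@residue T) A x -> (A x <-> ~~ odd k).
Proof.
elim/ltn_ind: k => -[|[|k]] IH; [by []|by case|].
by move=> /residue2_sub/(IH k (leqnSn _)); rewrite /= negbK.
Qed.

(** If [A] is [F] together with [G `&` C], where [G] is open and [F] and [C] are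
closed, then [G] avoids the first residue, so the second one, being in [A], is in
[F], and limits of [F] are still in [A]. If the third residue is empty, the second
one is closed and serves as [F]. *)
Lemma FLC1_residueP (T : topologicalType) (A : set T) :
  FLC1 A <-> iter 3 (@residue T) A = set0.
Proof.
rewrite /=; set Q1 := residue A; set Q2 := residue Q1.
split=> [[F [_ [cF [G [C [oG cC ->]]] AE]]] | Q3].
  have clA : closure A `<=` F `|` C.
    apply: closure_sub; first exact: closedU.
    by rewrite AE => y [|[_]]; [left|right].
  have Q1G : closure Q1 `<=` ~` G.
    apply: closure_sub => [|x]; first exact: open_closedC.
    move=> [/clA FCx nAx] Gx; apply: nAx; rewrite AE.
    by case: FCx => [Fx|Cx]; [left|right].
  have Q2F : closure Q2 `<=` F.
    apply: closure_sub => // x Q2x.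
    have := residue2_sub Q2x; rewrite AE => -[//|[Gx _]].
    by case: (Q1G _ Q2x.1).
  apply/seteqP; split=> // x Q3x; have [_] := residue2_sub Q3x; apply.
  by rewrite AE; left; apply: Q2F; case: Q3x.
have cQ2 : closed Q2.
  apply/closure_id/seteqP; split=> [|x clx]; first exact: subset_closure.
  by apply: contrapT => nx; rewrite -[False]/(set0 x) -Q3.
exists Q2, (~` closure Q1 `&` closure A); split=> //.
  exists (~` closure Q1), (closure A); split=> //; last exact: closed_closure.
  exact/closed_openC/closed_closure.
apply/seteqP; split=> [x Ax|x [|[nQ1 clAx]]]; last 2 first.
- exact: residue2_sub.
- by apply: contrapT => nAx; apply/nQ1/subset_closure.
have [Q1x|] := pselect (closure Q1 x).
  by left; split=> // -[].
by right; split=> //; exact: subset_closure.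
Qed.

(** * Branching families of points in metric spaces *)

Lemma closure_mdistP (R : realType) (T : metricType R) (A : set T) (x : T) :
  closure A x <-> forall e : R, 0 < e -> exists2 y, A y & mdist x y < e.
Proof.
split=> [clx e e0|H B].
  have [|y [Ay yB]] := clx (ball x e); first exact: nbhsx_ballx.
  by exists y => //; rewrite ballEmdist in yB.
rewrite -filter_from_mdist_nbhs => -[e /= e0 eB].
by have [y Ay xy] := H e e0; exists y; split=> //; exact: eB.
Qed.

(** Together with [s], the sequences that extend [s] through a child of index at
least [N]. In a branching family these sets correspond to the neighbourhoods of
the point of index [s]. *)
Definition below (s : seq nat) (N : nat) (t : seq nat) : Prop :=
  t = s \/ exists2 n, (N <= n)%N & exists t', t = s ++ n :: t'.

(** The points of index [s] of length at most [d] form a tree in which the whole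
subtree at the [n]-th child of [u] lies in the annulus of radii [r u n.+1] and
[r u n] around the point of index [u]. Annuli of distinct children do not overlap,
which keeps their subtrees apart. *)
Record branching (R : realType) (T : metricType R) (d : nat)
    (phi : seq nat -> T) (r : seq nat -> nat -> R) : Prop := Branching {
  branching_gt0 : forall u n, 0 < r u n;
  branching_decr : forall u n, r u n.+1 <= r u n;
  branching_small : forall u e, 0 < e -> exists n, r u n < e;
  branching_dist : forall u n t, (size (u ++ n :: t) <= d)%N ->
    r u n.+1 < mdist (phi u) (phi (u ++ n :: t)) < r u n }.

Section branching_theory.
Context (R : realType) (T : metricType R) (d : nat).
Context (phi : seq nat -> T) (r : seq nat -> nat -> R).
Hypothesis B : branching d phi r.

Lemma branching_homo u m n : (m <= n)%N -> r u n <= r u m.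
Proof.
elim: n => [|n IH]; first by rewrite leqn0 => /eqP ->.
rewrite leq_eqVlt => /predU1P[->//|/IH]; apply: le_trans.
exact: (branching_decr B).
Qed.

Lemma branching_near s (e : R) : 0 < e -> exists N, forall t,
  (size t <= d)%N -> below s N t -> mdist (phi s) (phi t) < e.
Proof.
move=> e0; have [N rN] := branching_small B s e0.
exists N => t td [->|[n Nn [t' tE]]]; first by rewrite mdistxx.
rewrite tE in td *; have /andP[_ /lt_trans] := branching_dist B td; apply.
exact: le_lt_trans (branching_homo _ Nn) rN.
Qed.

(** Let [u] be the longest common prefix of two indices, one of which is fixed.
If both go on after [u], the two points lie in different annuli around the point
of index [u], and the inequalities bounding the annulus of the fixed point are
strict, so their distance is bounded below; the same holds if the other index
stops at [u]. Hence points close to that of index [s] are indexed below [s], and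
the annuli around it exclude the children of small index. *)
Lemma branching_sep s N : (size s <= d)%N -> exists2 e : R, 0 < e &
  forall t, (size t <= d)%N -> mdist (phi s) (phi t) < e -> below s N t.
Proof.
(* The prefix [u] already shared by both indices is generalized, so that the
   induction can walk down [s]. *)
suff H u : (size (u ++ s) <= d)%N -> exists2 e : R, 0 < e &
    forall t, (size (u ++ t) <= d)%N ->
      mdist (phi (u ++ s)) (phi (u ++ t)) < e -> below s N t.
  exact: (H [::]).
elim: s u => [|n s IH] u usd.
  exists (r u N); first exact: (branching_gt0 B).
  move=> [|n t] utd; first by left.
  rewrite cats0 => utN; right; exists n; last by exists t.
  rewrite leqNgt; apply/negP => nN.
  have /andP[/(le_lt_trans (branching_homo u nN))] := branching_dist B utd.
  by move=> /lt_trans/(_ utN); rewrite ltxx.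
have [|e e0 He] := IH (rcons u n); first by rewrite cat_rcons.
have /andP[] := branching_dist B usd.
set a := mdist _ _ => ra ar.
exists (Num.min e (Num.min (a - r u n.+1) (r u n - a))).
  by rewrite !lt_min e0 !subr_gt0 ra ar.
move=> t utd; rewrite !lt_min => /and3P[se sr1 sr2].
have r0 : 0 < r u n.+1 := branching_gt0 B _ _.
case: t utd se sr1 sr2 => [|m t] utd se sr1 sr2.
  by move: sr1; rewrite cats0 metric_sym -/a; lra.
have [mn|nm|mn] := ltngtP m n; last first.
- rewrite mn in utd se *; rewrite -!cat_rcons in utd se.
  have [->|[k Nk [t' ->]]] := He _ utd se; first by left.
  by right; exists k => //; exists t'.
- have /andP[_] := branching_dist B utd.
  have := branching_homo u nm.
  have := metric_triangle (phi u) (phi (u ++ m :: t)) (phi (u ++ n :: s)).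
  rewrite -/a [mdist (phi (u ++ m :: t)) _]metric_sym; lra.
- have /andP[+ _] := branching_dist B utd.
  have := branching_homo u mn.
  have := metric_triangle (phi u) (phi (u ++ n :: s)) (phi (u ++ m :: t)).
  rewrite -/a; lra.
Qed.

(** Two indices of the same point are below each other for all [N]; an [N] larger
than every entry of one of them rules out proper extensions. *)
Lemma branching_inj :
  {in [set s | (size s <= d)%N] &, injective phi}.
Proof.
move=> s t /set_mem/= sd /set_mem/= td st.
have [e e0 /(_ t td)] := branching_sep (foldr maxn 0%N t).+1 sd.
rewrite st mdistxx => /(_ e0)[//|[n tn [t' tE]]].
suff : (n <= foldr maxn 0 t)%N by rewrite leqNgt tn.
rewrite tE; elim: s {sd st tn tE} => [|m s IH] /=; first exact: leq_maxl.
exact: leq_trans IH (leq_maxr _ _).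
Qed.

End branching_theory.

(** Small neighbourhoods in both families are the sets [below s N], whatever the
metric spaces. *)
Lemma branching_continuous (R : realType) (T V : metricType R) d
    (phi : seq nat -> T) r (psi : seq nat -> V) q (h : T -> V) :
  branching d phi r -> branching d psi q ->
  (forall s, (size s <= d)%N -> h (phi s) = psi s) ->
  {within phi @` [set s | (size s <= d)%N], continuous h}.
Proof.
move=> Bphi Bpsi hE; apply/subspace_continuousP => _ [s /= sd <-].
apply/cvgrPdist_lt => e e0; rewrite /from_subspace hE//.
have [N HN] := branching_near Bpsi s e0.
have [del del0 Hdel] := branching_sep Bphi N sd.
rewrite near_withinE; apply/nbhs_mdistP; exists del => //= y /= st [t td tE].
by move: st; rewrite -tE => st; rewrite hE//; apply: HN => //; exact: Hdel.
Qed.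

Lemma branching_homeo (R : realType) (T V : metricType R) d
    (phi : seq nat -> T) r (psi : seq nat -> V) q :
  branching d phi r -> branching d psi q ->
  exists2 h : T -> V, homeo_onto_image (phi @` [set s | (size s <= d)%N]) h &
    forall s, (size s <= d)%N -> h (phi s) = psi s.
Proof.
move=> Bphi Bpsi.
have phiK := pinvKV (fun=> [::]) (branching_inj Bphi).
have psiK := pinvKV (fun=> [::]) (branching_inj Bpsi).
set A := [set s | _] in phiK psiK *.
pose h := psi \o 'pinv_(fun=> [::]) A phi.
pose g := phi \o 'pinv_(fun=> [::]) A psi.
have hE s : A s -> h (phi s) = psi s by move=> As; rewrite /h/= phiK// inE.
have gE s : A s -> g (psi s) = phi s by move=> As; rewrite /g/= psiK// inE.
exists h => //; exists g; split.
- by move=> _ [s As <-]; rewrite hE// gE.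
- exact: branching_continuous Bphi Bpsi hE.
- suff -> : h @` (phi @` A) = psi @` A by exact: branching_continuous Bpsi Bphi gE.
  by rewrite image_comp; apply: eq_imagel => s As; exact: hE.
Qed.

Lemma exp2_small (R : realType) (e : R) : 0 < e -> exists n, 2 ^- n < e.
Proof.
move=> e0; exists (Num.trunc e^-1).+1.
rewrite -[ltRHS]invrK ltf_pV2 ?posrE ?invr_gt0 ?exprn_gt0//.
apply: (lt_trans (truncnS_gt _)); rewrite -natrX ltr_nat; exact: ltn_expl.
Qed.

(** A point of the residue of [Q] is a limit of points [y_n] of [Q], and is not one
of them. Choosing [y_n] at distance less than [q n], and then
[q n.+1] as half of this distance, puts [y_n] strictly inside the annulus of radii
[q n.+1] and [q n]; a family obtained by induction around [y_n], small enough to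
stay in that annulus, is grafted there. *)
Lemma iter_residue_branching (R : realType) (X : metricType R) (A : set X) k x
    (e : R) : 0 < e -> iter k (@residue X) A x ->
  exists phi r, [/\ branching k phi r, phi [::] = x &
    forall s, (size s <= k)%N ->
      iter (k - size s) (@residue X) A (phi s) /\ mdist x (phi s) < e].
Proof.
elim: k x e => [|k IH] x e e0 Qx.
  exists (fun=> x), (fun _ n => 2 ^- n); split=> // [|s].
    split=> [u n|u n|u|u n t]; first by rewrite invr_gt0 exprn_gt0.
    - by rewrite lef_pV2 ?posrE ?exprn_gt0// ler_eXn2l// ltr1n.
    - exact: exp2_small.
    - by rewrite size_cat/= addnS.
  by rewrite leqn0 => /eqP ->; rewrite mdistxx.
have [/closure_mdistP clx nQx] := Qx.
have /choice[f fP] (u : R) : exists y, 0 < u ->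
    [/\ iter k (@residue X) A y, 0 < mdist x y & mdist x y < u].
  have [u0|] := ltP 0 u; last by exists x.
  have [y Qy xy] := clx u u0; exists y => _; split=> //.
  by rewrite mdist_gt0; apply/eqP => xyE; apply: nQx; rewrite xyE.
pose q n := iter n (fun u => mdist x (f u) / 2) e.
have q0 n : 0 < q n.
  by elim: n => [//|n /fP[_ + _]] /=; move=> xf; rewrite divr_gt0.
have qP n := fP _ (q0 n).
have qS n : q n.+1 = mdist x (f (q n)) / 2 by [].
have qle n : q n <= e * 2 ^- n.
  elim: n => [|n IHn]; first by rewrite expr0 invr1 mulr1.
  have [_ _] := qP n; rewrite qS exprS invfM mulrCA; lra.
pose del n := Num.min (q n - mdist x (f (q n))) (mdist x (f (q n)) - q n.+1).
have /choice[p pP] n : exists p : (seq nat -> X) * (seq nat -> nat -> R),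
    [/\ branching k p.1 p.2, p.1 [::] = f (q n) &
    forall s, (size s <= k)%N -> iter (k - size s) (@residue X) A (p.1 s) /\
      mdist (f (q n)) (p.1 s) < del n].
  have [Qf fgt0 flt] := qP n.
  have [|phi [r H]] := IH _ (del n) _ Qf; last by exists (phi, r).
  by rewrite lt_min qS; apply/andP; split; lra.
have pdist n t : (size t <= k)%N -> q n.+1 < mdist x ((p n).1 t) < q n.
  move=> tk; have [_ _ /(_ t tk)[_]] := pP n.
  rewrite lt_min => /andP[].
  have := metric_triangle x (f (q n)) ((p n).1 t).
  have := metric_triangle x ((p n).1 t) (f (q n)).
  rewrite [mdist ((p n).1 t) _]metric_sym => *; apply/andP; split; lra.
exists (fun s => if s is n :: t then (p n).1 t else x).
exists (fun s => if s is n :: t then (p n).2 t else q); split=> //.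
- split.
  + by case=> [|m u] n //; have [[]] := pP m.
  + case=> [|m u] n; last by have [[]] := pP m.
    by have [_ ? ?] := qP n; rewrite qS; lra.
  + case=> [|m u] a a0; last by have [Bm _ _] := pP m; exact: branching_small Bm u a a0.
    have [n na] := exp2_small (divr_gt0 a0 e0); exists n.
    by apply: le_lt_trans (qle n) _; rewrite mulrC -ltr_pdivlMr.
  + case=> [|m u] n t /=; first exact: pdist.
    by rewrite ltnS; have [Bm _ _] := pP m; exact: branching_dist Bm u n t.
- case=> [|n t] /=; first by rewrite mdistxx.
  rewrite ltnS subSS => tk; have [_ _ /(_ t tk)[? _]] := pP n; split=> //.
  have /andP[_ /lt_le_trans] := pdist n t tk; apply.
  apply: le_trans (qle n) _.
  by rewrite ger_pMr// invf_le1 ?exprn_gt0// exprn_ege1// ler1n.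
Qed.

(** * The dyadic sets as a branching family *)

(** Entry [n] stands for a gap [n.+1] between consecutive exponents: the sum over
exponents [m1 < m2 < ...] is [2 ^- m1] times one plus the sum over the exponents
[m2 - m1 < ...]. *)
Definition dyadic_code (R : realType) (s : seq nat) : R :=
  foldr (fun n y => 2 ^- n.+1 * (1 + y)) 0 s.
Arguments dyadic_code : clear implicits.

Lemma dyadicS (R : realType) k :
  dyadic R k.+1 = [set 2 ^- n.+1 * (1 + y) | n in setT & y in dyadic R k].
Proof.
apply/seteqP; split=> [x [n [n0 nlt ->]]|_ [m _] [_ [n [n0 nlt ->]] <-]].
  exists (n ord0).-1 => //; exists (\sum_(i < k) 2 ^- (n (lift ord0 i) - n ord0)).
    exists (fun i => n (lift ord0 i) - n ord0)%N; split=> // [i|i j ij].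
      by rewrite subn_gt0 nlt.
    by rewrite ltn_sub2r ?nlt.
  rewrite prednK// mulrDr mulr1 big_ord_recl; congr (_ + _).
  rewrite mulr_sumr; apply: eq_bigr => i _.
  by rewrite -invfM -exprD subnKC// ltnW// nlt.
exists (fun i => if unlift ord0 i is Some j then m.+1 + n j else m.+1)%N; split.
- by move=> i; case: unliftP => //.
- move=> i j; case: unliftP => [i'|] ->; case: unliftP => [j'|] -> //=.
    by rewrite !/bump !add1n ltnS ltn_add2l; exact: nlt.
  by move=> _; rewrite -[ltnLHS]addn0 ltn_add2l n0.
- rewrite big_ord_recl unlift_none mulrDr mulr1; congr (_ + _).
  rewrite mulr_sumr; apply: eq_bigr => i _.
  by rewrite liftK exprD invfM.
Qed.

Lemma dyadic_codeE (R : realType) k :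
  dyadic R k = dyadic_code R @` [set s | size s = k].
Proof.
elim: k => [|k IH].
  rewrite dyadic0; apply/seteqP; split=> [_ ->|_ [s /= /size0nil -> <-] //].
  by exists [::].
rewrite dyadicS IH; apply/seteqP; split=> [_ [n _] [_ [s <- <-] <-]|].
  by exists (n :: s).
move=> _ [[//|n s] [sk] <-]; exists n => //.
by exists (dyadic_code R s) => //; exists s.
Qed.

Lemma S3_code (R : realType) :
  S3 R = dyadic_code R @` [set s | (size s <= 3)%N].
Proof.
rewrite /S3 !dyadic_codeE -!image_setU; congr (_ @` _).
apply/seteqP; split=> s /=; first by case=> [[[]|]|] ->.
by case: (size s) => [|[|[|[|n]]]] // _; [left; left; left|left; left; right|left; right|right].
Qed.

Lemma dyadic_code_bounds (R : realType) s :
  0 <= dyadic_code R s <= 1 - 2 ^- size s.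
Proof.
elim: s => [|n s /andP[IH0 IH1]] /=; first by rewrite expr0 invr1 subrr lexx.
have n0 : 0 < 2 ^- n.+1 :> R by rewrite invr_gt0 exprn_gt0.
have n1 : 2 ^- n.+1 <= 2^-1 :> R.
  by rewrite lef_pV2 ?posrE ?exprn_gt0// ler_eXnr// ler1n.
apply/andP; split; first by rewrite mulr_ge0 ?addr_ge0// ltW.
have := ler_pM (ltW n0) (addr_ge0 ler01 IH0) n1 (lerD (lexx 1) IH1).
by rewrite [2 ^+ (size s).+1]exprS invfM; lra.
Qed.

Lemma dyadic_code_cat (R : realType) u t : dyadic_code R (u ++ t) =
  dyadic_code R u + 2 ^- sumn (map succn u) * dyadic_code R t.
Proof.
elim: u => [|n u IH] /=; first by rewrite expr0 invr1 mul1r add0r.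
by rewrite IH exprD invfM addrA mulrDr mulrA.
Qed.

(** The numbers in the subtree at the [n]-th child of [u] are at distance
[2 ^- n.+1 * (1 + v)] from that of [u], up to the scale [2 ^- m] of [u], where
[0 <= v <= 1 - 2 ^- (d - 1)] as at most [d - 1] entries remain. Radii proportional to
[c * 2 ^- n] bound these if [1 - 2 ^- d < c < 1], whence [c = 1 - 2 ^- d.+1]. *)
Lemma dyadic_code_branching (R : realType) d :
  branching d (dyadic_code R : seq nat -> R^o)
    (fun u n => 2 ^- sumn (map succn u) * ((1 - 2 ^- d.+1) * 2 ^- n)).
Proof.
have p0 n : 0 < 2 ^- n :> R by rewrite invr_gt0 exprn_gt0.
have pS n : 2 ^- n.+1 = 2 ^- n / 2 :> R by rewrite exprS invfM mulrC.
have ple n : 2 ^- n <= 1 :> R by rewrite invf_le1 ?exprn_gt0// exprn_ege1// ler1n.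
have c0 : 0 < 1 - 2 ^- d.+1 :> R by rewrite pS; have := ple d; lra.
split=> [u n|u n|u e e0|u n t utd].
- by rewrite !mulr_gt0.
- rewrite ler_pM2l// ler_pM2l// pS; have := p0 n; lra.
- have [n ne] := exp2_small e0; exists n; apply: le_lt_trans ne.
  rewrite mulrA ger_pMl// mulr_ile1 ?ple ?(ltW (p0 _)) ?(ltW c0)//.
- rewrite /mdist/= dyadic_code_cat [X in `|X|]addrC addKr.
  have /andP[t0 t1] := dyadic_code_bounds R t.
  rewrite gtr0_norm; last by rewrite /= !mulr_gt0// ltr_wpDr.
  rewrite !ltr_pM2l//= pS.
  have td : 2 ^- d <= 2 ^- (size t).+1 :> R.
    rewrite lef_pV2 ?posrE ?exprn_gt0// ler_eXn2l ?ltr1n//.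
    by rewrite size_cat/= in utd; apply: leq_trans utd; exact: leq_addl.
  rewrite !pS in td *; set v := dyadic_code R t in t0 t1 *.
  have lo : 0 < 2 ^- n * (v + 2 ^- d / 2).
    by rewrite mulr_gt0// ltr_wpDl// divr_gt0.
  have hi : 0 < 2 ^- n * (1 - 2 ^- d - v).
    by rewrite mulr_gt0//; have := p0 (size t); lra.
  by apply/andP; split; lra.
Qed.

(** * Embedded copies of [S3] *)

(** As [h] and [dyadic_code] are injective, the trace of [A] can be read index by
index: the sets [D_0, ..., D_3] and their images are disjoint. *)
Lemma S3_patternP (R : realType) (X : topologicalType) (h : R -> X) (A : set X) :
  homeo_onto_image (S3 R) h ->
  (A `&` h @` S3 R = h @` dyadic R 1 `|` h @` dyadic R 3 <->
   forall s, (size s <= 3)%N -> (A (h (dyadic_code R s)) <-> odd (size s))).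
Proof.
move=> [g [hK _ _]].
have codeP s : (size s <= 3)%N -> S3 R (dyadic_code R s).
  by move=> s3; rewrite S3_code; exists s.
have hinj s t : (size s <= 3)%N -> (size t <= 3)%N ->
    h (dyadic_code R s) = h (dyadic_code R t) -> s = t.
  move=> s3 t3 /(congr1 g); rewrite !hK; [|exact: codeP..].
  by apply: (branching_inj (dyadic_code_branching R 3)); rewrite inE.
have img (P : set (seq nat)) s : P s ->
    (h @` (dyadic_code R @` P)) (h (dyadic_code R s)).
  by move=> Ps; exists (dyadic_code R s) => //; exists s.
rewrite S3_code !dyadic_codeE; split=> [AE s s3|AP].
  split=> [As|].
    have : (A `&` h @` (dyadic_code R @` [set t | (size t <= 3)%N]))
        (h (dyadic_code R s)).
      by split=> //; exact: img.
    rewrite AE => -[] [_ [t /= tk <-]] /hinj <-//; by rewrite tk.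
  move=> so; suff : (A `&` h @` (dyadic_code R @` [set t | (size t <= 3)%N]))
      (h (dyadic_code R s)) by case.
  rewrite AE; case: s s3 so => [|a [|b [|c [|]]]] // _ _; [left|right];
    exact: img.
apply/seteqP; split=> [y [+ [_ [s /= s3 <-] yE]]|].
  rewrite -yE {y yE} => /(AP s s3); case: s s3 => [|a [|b [|c [|]]]] // _ _; [left|right];
    exact: img.
move=> _ [] [_ [s /= sk <-] <-]; split; try by apply/AP; rewrite sk.
  by apply: img; rewrite /= sk.
by apply: img; rewrite /= sk.
Qed.

(** A branching family around a point of the third residue is homeomorphic to [S3],
and parity tells which of its points are in [A]. Conversely a copy of [S3] climbs
through the residues: each point of index [s] shorter than 3 is the limit of those
of index [rcons s n], and lies on the other side of [A]. *)
Lemma not_FLC1_S3P (R : realType) (X : metricType R) (A : set X) :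
  ~ FLC1 A <-> exists h : R -> X, homeo_onto_image (S3 R) h /\
    A `&` h @` S3 R = h @` dyadic R 1 `|` h @` dyadic R 3.
Proof.
have Bval := dyadic_code_branching R 3.
split=> [nA|[h [hh]]].
  have /eqP/set0P[x Qx] : iter 3 (@residue X) A <> set0 by move/FLC1_residueP.
  have [phi [r [Bphi _ phiQ]]] := iter_residue_branching ltr01 Qx.
  have [h hh hE] := branching_homeo Bval Bphi.
  have hS3 : homeo_onto_image (S3 R) h by rewrite S3_code.
  exists h; split=> //; apply/(S3_patternP _ hS3) => s s3; rewrite hE//.
  have [/(@iter_residue_parity X A) Aphi _] := phiQ s s3.
  by apply: iff_trans Aphi _; rewrite oddB// negbK.
move=> /(S3_patternP _ hh) AP /FLC1_residueP Q3.
have [g [_ hc _]] := hh; move/subspace_continuousP in hc.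
have lim s (B : set X) : (size s < 3)%N ->
    (forall n, B (h (dyadic_code R (rcons s n)))) ->
    closure B (h (dyadic_code R s)).
  move=> s3 hB; apply/closure_mdistP => e e0.
  have /hc/cvgrPdist_lt/(_ e e0) : S3 R (dyadic_code R s).
    by rewrite S3_code; exists s => //=; exact: ltnW.
  rewrite near_withinE => /(@nbhs_mdistP R R^o)[del /= del0 Hdel].
  have [N HN] := branching_near Bval s del0.
  have sN : (size (rcons s N) <= 3)%N by rewrite size_rcons.
  exists (h (dyadic_code R (rcons s N))) => //; apply: Hdel.
    by apply: HN => //; right; exists N => //; exists [::]; rewrite cats1.
  by rewrite S3_code; exists (rcons s N).
(* Level [3 - k] of the copy lies in the [k]-th residue; its root then
   contradicts the emptiness of the third one. *)
suff H k s : (size s + k = 3)%N ->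
    iter k (@residue X) A (h (dyadic_code R s)).
  by have := H 3 [::] erefl; rewrite Q3.
elim: k s => [|k IH] s sk.
  by rewrite addn0 in sk; apply/AP; rewrite sk.
have s3 : (size s < 3)%N by rewrite -sk addnS ltnS leq_addr.
split; first by apply: lim => // n; apply: IH; rewrite size_rcons addSnnS.
move=> /(@iter_residue_parity X A k); have := AP _ (ltnW s3).
have := congr1 odd sk; rewrite oddD /=.
by case: (odd (size s)); case: (odd k) => //= _ [a b] [c d];
  [have := c (b isT)|have := a (d isT)].
Qed.

Theorem mainTheorem5 (R : realType) (X Y : metricType R) (f : X -> Y) :
  not_FLC1_measurable f <-> exists x : X, not_FLC1_measurable_at f x.
Proof.
split=> [[U [oU /not_FLC1_S3P[h [hh hE]]]]|[_ [U [h [oU hh _ hE]]]]].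
  by exists (h 0), U, h.
by exists U; split=> //; apply/not_FLC1_S3P; exists h.
Qed.
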